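(* Let $\boldsymbol S=\boldsymbol\Theta\boldsymbol\Theta^T+\boldsymbol W$ be as in the context (MAXBET model). If the noise $\boldsymbol W$ is small in the sense that $$m\ \ge\ \|\boldsymbol W\|(4\sqrt r+1)+\max_{1\le i\le m}\|[\boldsymbol W\boldsymbol\Theta]_i\|_F+4\|\boldsymbol W\|^2\sqrt{\tfrac rm}+\frac{2m\left(\max_{1\le i\le m}\|[\boldsymbol W\boldsymbol\Theta]_i\|_F+4\|\boldsymbol W\|^2\sqrt{\tfrac rm}\right)}{m-4\|\boldsymbol W\|\sqrt r}+16\|\boldsymbol W\|^2\frac rm ,$$ then every candidate critical point $\boldsymbol O=(\boldsymbol O_1,\dots,\boldsymbol O_m)$ of (OTSM) satisfying $\mathrm{tr}(\boldsymbol\Theta^T\boldsymbol S\boldsymbol\Theta)\le\mathrm{tr}(\boldsymbol O^T\boldsymbol S\boldsymbol O)$ is a global optimum of (OTSM).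
   Context: Let $m,r\ge1$ and $d_1,\dots,d_m$ be integers with $r\le\min_i d_i$, and $D=\sum_{i=1}^m d_i$. $\mathcal O_{d,r}=\{\boldsymbol O\in\mathbb R^{d\times r}:\boldsymbol O^T\boldsymbol O=\mathbf I_r\}$. A $D\times D$ matrix $\boldsymbol X$ is partitioned into blocks $\boldsymbol X_{ij}\in\mathbb R^{d_i\times d_j}$, and a $D\times r$ matrix $\boldsymbol Y$ into blocks $\boldsymbol Y_i=[\boldsymbol Y]_i\in\mathbb R^{d_i\times r}$. A tuple $(\boldsymbol O_1,\dots,\boldsymbol O_m)$ is identified with the stacked matrix $\boldsymbol O\in\mathbb R^{D\times r}$. $\|\cdot\|$ is the operator norm and $\|\cdot\|_F$ the Frobenius norm. MAXBET model: $\boldsymbol\Theta_i\in\mathcal O_{d_i,r}$ for $i=1,\dots,m$, $\boldsymbol\Theta\in\mathbb R^{D\times r}$ is the matrix with blocks $\boldsymbol\Theta_i$, $\boldsymbol W\in\mathbb R^{D\times D}$ is symmetric, and $\boldsymbol S_{ij}=\boldsymbol\Theta_i\boldsymbol\Theta_j^T+\boldsymbol W_{ij}$ for all $1\le i,j\le m$, i.e. $\boldsymbol S=\boldsymbol\Theta\boldsymbol\Theta^T+\boldsymbol W$. (OTSM): maximize $\sum_{i,j=1}^m\mathrm{tr}(\boldsymbol O_i^T\boldsymbol S_{ij}\boldsymbol O_j)=\mathrm{tr}(\boldsymbol O^T\boldsymbol S\boldsymbol O)$ subject to $\boldsymbol O_i\in\mathcal O_{d_i,r}$, $i=1,\dots,m$.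 A point $\boldsymbol O\in\prod_i\mathcal O_{d_i,r}$ is a critical point if for every $i$ there is a symmetric $\boldsymbol\Lambda_i\in\mathbb R^{r\times r}$ with $\boldsymbol O_i\boldsymbol\Lambda_i=\sum_{j=1}^m\boldsymbol S_{ij}\boldsymbol O_j$ (so that $\boldsymbol\Lambda_i=\boldsymbol O_i^T\sum_{j=1}^m\boldsymbol S_{ij}\boldsymbol O_j$). It is a candidate critical point if in addition every $\boldsymbol\Lambda_i$ is positive semidefinite.
   Formalization: The formal theorem additionally assumes m − 4‖W‖√r > 0; when this denominator is negative the noise inequality can hold for large W and the claim fails (e.g. m = 101, r = 1, ‖W‖ = 26), and when it is zero the fraction is undefined. *)

(* Defs.v *)
From HB Require Import structures.
From mathcomp Require Import all_boot all_order all_algebra.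
From mathcomp Require Import boolp classical_sets reals.

Set Implicit Arguments.
Unset Strict Implicit.
Unset Printing Implicit Defensive.

Import Order.TTheory GRing.Theory Num.Theory.
Local Open Scope classical_set_scope.
Local Open Scope ring_scope.

Definition frobenius (R : realType) (p q : nat) (A : 'M[R]_(p, q)) : R :=
  Num.sqrt (\sum_i \sum_j A i j ^+ 2).

(* On column vectors [frobenius] is the Euclidean norm; the norm [`|x|] that
   mathcomp-analysis puts on matrices is the max norm and is not used here. *)
Definition opnorm (R : realType) (p q : nat) (A : 'M[R]_(p, q)) : R :=
  sup [set frobenius (A *m x) | x in [set x : 'cV[R]_q | frobenius x <= 1]].

Definition psd (R : realType) (n : nat) (A : 'M[R]_n) : Prop :=
  A^T = A /\ forall x : 'cV[R]_n, 0 <= (x^T *m A *m x) 0 0.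

Definition stiefel (R : realType) (p r : nat) (O : 'M[R]_(p, r)) : Prop :=
  O^T *m O = 1%:M.

Section OTSM.
Variables (R : realType) (m r : nat) (d : 'I_m -> nat).
Implicit Types (S : 'M[R]_(\sum_(i < m) d i)) (O : 'M[R]_(\sum_(i < m) d i, r)).

(* A tuple (O_1, ..., O_m) is the stacked matrix O, with O_i = [submxcol O i]
   and S_ij = [submxblock S i j]. *)
Definition feasible O : Prop := forall i, stiefel (submxcol O i).

Definition objective S O : R :=
  \sum_(i < m) \sum_(j < m)
    \tr ((submxcol O i)^T *m submxblock S i j *m submxcol O j).

Lemma objectiveE S O : objective S O = \tr (O^T *m S *m O).
Proof.
rewrite -[in RHS](submxcolK O) -[in RHS](submxblockK S) tr_mxcol.
rewrite mul_mxrow_mxblock mul_mxrow_mxcol raddf_sum /= /objective exchange_big.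
by apply: eq_bigr => j _; rewrite mulmx_suml raddf_sum.
Qed.

Definition multiplier S O (i : 'I_m) (L : 'M[R]_r) : Prop :=
  L^T = L /\
  submxcol O i *m L = \sum_(j < m) submxblock S i j *m submxcol O j.

Definition critical_point S O : Prop :=
  feasible O /\ forall i, exists L : 'M[R]_r, multiplier S O i L.

(* On a feasible O the multiplier at i is unique, as O_i has orthonormal
   columns. *)
Definition candidate_critical_point S O : Prop :=
  critical_point S O /\ forall i (L : 'M[R]_r), multiplier S O i L -> psd L.

Definition global_optimum S O : Prop :=
  feasible O /\
  forall U : 'M[R]_(\sum_(i < m) d i, r),
    feasible U -> objective S U <= objective S O.

(* The terms are nonnegative, so starting the maximum at 0 is harmless. *)
Definition max_block_frobenius O : R :=
  \big[Num.max/0]_(i < m) frobenius (submxcol O i).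

End OTSM.

(* Main.v *)
Require Import Defs.
From HB Require Import structures.
From mathcomp Require Import all_boot all_order all_algebra.
From mathcomp Require Import boolp classical_sets reals.
From mathcomp Require Import topology normedtype derive.
From mathcomp Require Import ring lra.

Set Implicit Arguments.
Unset Strict Implicit.
Unset Printing Implicit Defensive.

Import Order.TTheory GRing.Theory Num.Theory.
Import numFieldNormedType.Exports.
Local Open Scope classical_set_scope.
Local Open Scope ring_scope.

(** The proof produces a dual certificate.  Let [L i] be the multipliers of the
    critical point [O], and suppose that every [L i - tau] is positive
    semidefinite.  The block-diagonal matrix [C] with blocks
    [O_i (L i - tau) O_i^T + tau I] has three properties: [C O = S O];
    [C >= tau I]; and [tr (U^T C U)] is maximal at [U = O] among feasible [U],
    because compressing a positive semidefinite matrix by a contraction cannot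
    increase its trace.  So [O] is globally optimal as soon as [S <= tau I] on the
    orthogonal complement of the columns of [O]: this is
    [global_optimum_of_certificate].

    It remains to find such a [tau].  The model and all quantities in the
    hypotheses are invariant under [Theta := Theta Q] with [Q] orthogonal, and
    by the polar decomposition [polar_factor] one may choose [Q] so that
    [H := Theta^T O] is symmetric positive semidefinite.  Put [D := O - Theta],
    [w := |W|] and [q := sqrt (r / m)].  Then [D^T D = 2 (m - H)], which
    makes everything explicit:
    - comparing the objectives of [O] and [Theta] gives [|D|_F <= 4 w q]
      ([aligned_distance]);
    - hence [H >= h := m - 4 w sqrt r] ([aligned_overlap_ge]), and the noise
      [(W O)_i] has norm at most [a := max_i |(W Theta)_i|_F + 4 w^2 q];
    - stationarity reads [O_i L_i = Theta_i H + (W O)_i], so [O_i] and [Theta_i]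
      are the polar factors of two matrices at distance at most [a], whence
      [|O_i - Theta_i|_F <= 2 a / h] ([block_distance]);
    - inserting this in the same equation gives
      [L_i >= h - 2 m a / h - a] ([multiplier_form_ge]);
    - if [O^T Z = 0] then [Theta^T Z = - D^T Z], so [S <= w + 16 w^2 r / m]
      there ([form_orthogonal_le]).
    The smallness assumption on [W] says exactly that the last upper bound is at
    most the previous lower bound, and [tau := w + 16 w^2 r / m] works.

    All estimates on quadratic forms are stated for traces [tr (X^T K X)] with a
    matrix [X] in place of a vector, so that Cauchy-Schwarz for the trace inner
    product and submultiplicativity of the Frobenius norm replace every spectral
    argument. *)

(** * The Frobenius norm and the operator norm *)

Section Frobenius.

Variable R : realType.

Lemma mxtrace_trmx_mulE p q (A B : 'M[R]_(p, q)) :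
  \tr (A^T *m B) = \sum_i \sum_j A i j * B i j.
Proof.
rewrite exchange_big /mxtrace; apply: eq_bigr => j _; rewrite mxE.
by apply: eq_bigr => i _; rewrite mxE.
Qed.

Lemma mxtrace_trmx_mulC p q (A B : 'M[R]_(p, q)) :
  \tr (A^T *m B) = \tr (B^T *m A).
Proof. by rewrite -mxtrace_tr trmx_mul trmxK. Qed.

Lemma frobenius_ge0 p q (A : 'M[R]_(p, q)) : 0 <= frobenius A.
Proof. exact: sqrtr_ge0. Qed.

Lemma frobenius_sqr p q (A : 'M[R]_(p, q)) :
  frobenius A ^+ 2 = \tr (A^T *m A).
Proof.
rewrite mxtrace_trmx_mulE sqr_sqrtr; last first.
  by apply: sumr_ge0 => i _; apply: sumr_ge0 => j _; exact: sqr_ge0.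
by apply: eq_bigr => i _; apply: eq_bigr => j _; rewrite expr2.
Qed.

Lemma mxtrace_gram_ge0 p q (A : 'M[R]_(p, q)) : 0 <= \tr (A^T *m A).
Proof. by rewrite -frobenius_sqr sqr_ge0. Qed.

Lemma frobenius_eq0 p q (A : 'M[R]_(p, q)) : frobenius A = 0 -> A = 0.
Proof.
move=> A0; have : \tr (A^T *m A) = 0 by rewrite -frobenius_sqr A0 expr0n.
rewrite mxtrace_trmx_mulE => /eqP; rewrite psumr_eq0; last first.
  by move=> i _; apply: sumr_ge0 => j _; rewrite -expr2 sqr_ge0.
move=> /allP Ai0; apply/matrixP => i j; rewrite mxE.
have /implyP/(_ isT) := Ai0 i (mem_index_enum i).
rewrite psumr_eq0 => [/allP/(_ j (mem_index_enum j))|k _].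
  by rewrite mulf_eq0 orbb => /eqP.
by rewrite -expr2 sqr_ge0.
Qed.

Lemma frobeniusN p q (A : 'M[R]_(p, q)) : frobenius (- A) = frobenius A.
Proof.
rewrite /frobenius; congr Num.sqrt; apply: eq_bigr => i _.
by apply: eq_bigr => j _; rewrite mxE sqrrN.
Qed.

Lemma frobenius_tr p q (A : 'M[R]_(p, q)) : frobenius A^T = frobenius A.
Proof.
apply/eqP; rewrite -(eqrXn2 (n := 2)) ?frobenius_ge0 //.
by rewrite !frobenius_sqr trmxK mxtrace_mulC.
Qed.

(** The Cauchy-Schwarz inequality, from
    [0 <= | |B| A - |A| B |^2]. *)
Lemma mxtrace_trmx_mul_le p q (A B : 'M[R]_(p, q)) :
  \tr (A^T *m B) <= frobenius A * frobenius B.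
Proof.
set a := frobenius A; set b := frobenius B.
have [a0 b0] : 0 <= a /\ 0 <= b by rewrite !frobenius_ge0.
have [/eqP ab0|abN0] := eqVneq (a * b) 0.
  move: ab0; rewrite mulf_eq0 => /orP[] /eqP /frobenius_eq0 ->.
    by rewrite trmx0 mul0mx mxtrace0 mulr_ge0.
  by rewrite mulmx0 mxtrace0 mulr_ge0.
have ab0 : 0 < a * b by rewrite lt_neqAle eq_sym abN0 mulr_ge0.
have := mxtrace_gram_ge0 (b *: A - a *: B).
rewrite [(_ - _)^T]linearB /= ![(_ *: _)^T]linearZ /= !mulmxBl !mulmxBr.
rewrite -!scalemxAl -!scalemxAr !raddfB /= !mxtraceZ -!frobenius_sqr -/a -/b.
rewrite (mxtrace_trmx_mulC B A).
by move=> square_ge0; rewrite -(ler_pM2l ab0); lra.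
Qed.

Lemma frobeniusD p q (A B : 'M[R]_(p, q)) :
  frobenius (A + B) <= frobenius A + frobenius B.
Proof.
rewrite -(ler_pXn2r (n := 2)) ?nnegrE ?addr_ge0 ?frobenius_ge0 //.
rewrite frobenius_sqr [(_ + _)^T]linearD /= mulmxDl !mulmxDr !raddfD /=.
rewrite -!frobenius_sqr (mxtrace_trmx_mulC B A).
have := mxtrace_trmx_mul_le A B; lra.
Qed.

Lemma frobenius_sqr_col p q (A : 'M[R]_(p, q)) :
  frobenius A ^+ 2 = \sum_j frobenius (col j A) ^+ 2.
Proof.
rewrite frobenius_sqr mxtrace_trmx_mulE exchange_big; apply: eq_bigr => j _.
rewrite frobenius_sqr mxtrace_trmx_mulE; apply: eq_bigr => i _.
by rewrite big_ord1 !mxE.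
Qed.

Lemma frobenius_mul p q s (A : 'M[R]_(p, q)) (B : 'M[R]_(q, s)) :
  frobenius (A *m B) <= frobenius A * frobenius B.
Proof.
rewrite -(ler_pXn2r (n := 2)) ?nnegrE ?mulr_ge0 ?frobenius_ge0 //.
rewrite exprMn (frobenius_sqr_col B) mulr_sumr (frobenius_sqr_col (A *m B)).
apply: ler_sum => j _; rewrite -[frobenius A]frobenius_tr.
rewrite [frobenius A^T ^+ 2]frobenius_sqr_col mulr_suml frobenius_sqr.
rewrite mxtrace_trmx_mulE.
apply: ler_sum => i _; rewrite big_ord1 -expr2 -exprMn.
have -> : col j (A *m B) i 0 = \tr ((col i A^T)^T *m col j B).
  rewrite mxtrace_trmx_mulE !mxE; apply: eq_bigr => k _.
  by rewrite big_ord1 !mxE.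
have h1 := mxtrace_trmx_mul_le (col i A^T) (col j B).
have h2 := mxtrace_trmx_mul_le (- col i A^T) (col j B).
rewrite -real_normK ?num_real // lerXn2r ?nnegrE ?mulr_ge0 ?frobenius_ge0 //.
rewrite ler_norml h1 andbT lerNl.
move: h2; rewrite [(- _)^T]linearN /= mulNmx linearN /=.
by rewrite frobeniusN.
Qed.

Lemma frobeniusZ p q (c : R) (A : 'M[R]_(p, q)) : 0 <= c ->
  frobenius (c *: A) = c * frobenius A.
Proof.
move=> c0; apply/eqP; rewrite -(eqrXn2 (n := 2)) ?mulr_ge0 ?frobenius_ge0 //.
rewrite exprMn !frobenius_sqr [(_ *: _)^T]linearZ /= -scalemxAl -scalemxAr.
by rewrite !mxtraceZ mulrA expr2.
Qed.

Lemma frobenius0 p q : frobenius (0 : 'M[R]_(p, q)) = 0.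
Proof. by rewrite -(scale0r 0) frobeniusZ // mul0r. Qed.

Lemma opnorm_has_ubound p q (A : 'M[R]_(p, q)) :
  has_ubound
    [set frobenius (A *m x) | x in [set x : 'cV[R]_q | frobenius x <= 1]].
Proof.
exists (frobenius A) => _ [x /= x1 <-]; apply: le_trans (frobenius_mul _ _) _.
by rewrite ler_piMr ?frobenius_ge0.
Qed.

Lemma opnorm_col p q (A : 'M[R]_(p, q)) (x : 'cV[R]_q) :
  frobenius (A *m x) <= opnorm A * frobenius x.
Proof.
have [/frobenius_eq0 ->|xN0] := eqVneq (frobenius x) 0.
  by rewrite mulmx0 !frobenius0 mulr0.
have x0 : 0 < frobenius x by rewrite lt_neqAle eq_sym xN0 frobenius_ge0.
rewrite -ler_pdivrMr // mulrC -frobeniusZ ?invr_ge0 ?frobenius_ge0 //.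
rewrite scalemxAr; apply: ub_le_sup; first exact: opnorm_has_ubound.
exists ((frobenius x)^-1 *: x) => //=.
by rewrite frobeniusZ ?invr_ge0 ?frobenius_ge0 // mulVf.
Qed.

Lemma opnorm_ge0 p q (A : 'M[R]_(p, q)) : 0 <= opnorm A.
Proof.
apply: ub_le_sup; first exact: opnorm_has_ubound.
by exists 0; rewrite /= ?mulmx0 frobenius0 ?ler01.
Qed.

Lemma frobenius_mul_opnorm p q s (A : 'M[R]_(p, q)) (X : 'M[R]_(q, s)) :
  frobenius (A *m X) <= opnorm A * frobenius X.
Proof.
rewrite -(ler_pXn2r (n := 2)) ?nnegrE ?mulr_ge0 ?frobenius_ge0 ?opnorm_ge0 //.
rewrite exprMn !(frobenius_sqr_col (_ : 'M_(_, s))) mulr_sumr.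
apply: ler_sum => j _; rewrite -exprMn.
rewrite lerXn2r ?nnegrE ?mulr_ge0 ?frobenius_ge0 ?opnorm_ge0 //.
by rewrite colE -mulmxA -colE opnorm_col.
Qed.

End Frobenius.

(** * Polar decomposition of a real square matrix *)

Section Polar.
Variable R : realType.

Lemma continuous_sum_fun (T : topologicalType) (I : Type) (s : seq I)
    (f : I -> T -> R) :
  (forall i, continuous (f i)) -> continuous (fun x => \sum_(i <- s) f i x).
Proof.
move=> fc x; elim: s => [|i s IHs].
  by under eq_fun do rewrite big_nil; exact: cvg_cst.
by under eq_fun do rewrite big_cons; apply: cvgD => //; exact: fc.
Qed.

Lemma continuous_mul_fun (T : topologicalType) (f g : T -> R) :
  continuous f -> continuous g -> continuous (fun x => f x * g x).
Proof. by move=> fc gc x; apply: cvgM; [exact: fc|exact: gc]. Qed.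

(** The orthogonal group is compact, being closed and contained in the unit
    cube of entries. *)
Lemma orthogonal_procrustes_max n (A : 'M[R]_n) :
  exists2 Q : 'M[R]_n, stiefel Q &
    forall P : 'M[R]_n, stiefel P -> \tr (P^T *m A) <= \tr (Q^T *m A).
Proof.
pose K := [set v : 'rV[R]_(n * n) | stiefel (vec_mx v)]%classic.
pose f (v : 'rV[R]_(n * n)) := \tr ((vec_mx v)^T *m A).
have entry_cont i j : continuous (fun v : 'rV[R]_(n * n) => vec_mx v i j).
  by move=> v; under eq_fun do rewrite mxE; exact: coord_continuous.
have gramE (P : 'M[R]_n) i j : (P^T *m P) i j = \sum_k P k i * P k j.
  by rewrite mxE; apply: eq_bigr => k _; rewrite mxE.
have K0 : (K !=set0)%classic.
  by exists (mxvec 1%:M); rewrite /K /stiefel /= mxvecK trmx1 mul1mx.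
have KE : K = \bigcap_(ij : 'I_n * 'I_n)
    (fun v => \sum_k vec_mx v k ij.1 * vec_mx v k ij.2)
      @^-1` [set (1%:M : 'M[R]_n) ij.1 ij.2].
  apply/seteqP; split=> v /=.
    by move=> vK ij _ /=; rewrite -gramE vK.
  by move=> vK; apply/matrixP => i j; rewrite gramE; exact: (vK (i, j)).
have Kclosed : closed K.
  rewrite KE; apply: closed_bigI => ij _; apply: closed_comp; last first.
    exact: closed_eq.
  move=> v _; apply: continuous_sum_fun => k.
  by apply: continuous_mul_fun; exact: entry_cont.
have Kcompact : compact K.
  have cube_compact :=
    rV_compact (n := n * n) (fun=> @segment_compact R (-1) 1).
  apply: (subclosed_compact Kclosed cube_compact).
  move=> v vK l; case/mxvec_indexP: l => i j.
  have := gramE (vec_mx v) j j; rewrite vK !mxE eqxx /= (bigD1 i) //=.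
  have : 0 <= \sum_(k < n | k != i) vec_mx v k j * vec_mx v k j.
    by apply: sumr_ge0 => k _; rewrite -expr2 sqr_ge0.
  rewrite mxE in_itv /=; move: (v 0 _) => x; set s := \sum_(k < n | _) _.
  move=> s0 e; apply/andP; split; nra.
have fcont : continuous f.
  rewrite (_ : f = fun v => \sum_j \sum_i vec_mx v i j * A i j); last first.
    apply/funext => v; apply: eq_bigr => j _; rewrite mxE.
    by apply: eq_bigr => i _; rewrite mxE.
  apply: continuous_sum_fun => j; apply: continuous_sum_fun => i.
  by apply: continuous_mul_fun; [exact: entry_cont|exact: cst_continuous].
have [v vK vmax] := compact_EVT_max K0 Kcompact (continuous_subspaceT fcont).
exists (vec_mx v); first by rewrite inE in vK.
by move=> P PK; rewrite -(mxvecK P); apply: vmax; rewrite inE /K /= mxvecK.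
Qed.

(** The Householder reflection in the hyperplane orthogonal to [x]. *)
Definition reflection n (x : 'cV[R]_n) : 'M[R]_n :=
  1%:M - (2 / (x^T *m x) 0 0) *: (x *m x^T).

Lemma reflection_tr n (x : 'cV[R]_n) : (reflection x)^T = reflection x.
Proof. by rewrite /reflection linearB /= linearZ /= trmx_mul trmxK trmx1. Qed.

Lemma reflection_stiefel n (x : 'cV[R]_n) :
  (x^T *m x) 0 0 != 0 -> stiefel (reflection x).
Proof.
move=> x0; rewrite /stiefel reflection_tr /reflection.
set c := 2 / _; rewrite mulmxBl mul1mx mulmxBr mulmx1 -scalemxAl -scalemxAr.
have -> : x *m x^T *m (x *m x^T) = (x^T *m x) 0 0 *: (x *m x^T).
  rewrite mulmxA -(mulmxA x) {1}[x^T *m x]mx11_scalar.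
  by rewrite mul_mx_scalar -scalemxAl.
rewrite !scalerA -[RHS]subr0 -addrA; congr (_ + _).
rewrite -opprD -scalerBl -scalerDl.
suff -> : c + (c - c * c * (x^T *m x) 0 0) = 0 by rewrite scale0r.
by rewrite /c; field.
Qed.

Lemma mxtrace_outer n (x y : 'cV[R]_n) (H : 'M[R]_n) :
  \tr (x *m y^T *m H) = (y^T *m H *m x) 0 0.
Proof. by rewrite -mulmxA mxtrace_mulC trace_mx11. Qed.

Lemma eq0_of_linear_le_quadratic (b c : R) :
  (forall t, b * t <= c * t ^+ 2) -> b = 0.
Proof.
move=> h; set t := b / (`|c| + 1).
have bE : b = t * (`|c| + 1) by rewrite divfK // gt_eqF // ltr_wpDl.
have := h t; have := ler_norm c; rewrite {1}bE => c_le bt_le.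
suff /eqP : t ^+ 2 = 0 by rewrite sqrf_eq0 bE => /eqP ->; rewrite mul0r.
by apply/eqP; rewrite eq_le sqr_ge0 andbT; have := sqr_ge0 t; nra.
Qed.

(** The optimality of the identity is tested on two families only.  One
    reflection yields nonnegativity of the form.  A product of two reflections
    in the hyperplanes orthogonal to [x] and [x + t z] is a rotation by an angle
    of order [t]; the first-order term in [t] yields symmetry. *)
Lemma psd_of_procrustes_max n (H : 'M[R]_n) :
  (forall P : 'M[R]_n, stiefel P -> \tr (P^T *m H) <= \tr H) -> psd H.
Proof.
move=> Hmax.
pose b (x y : 'cV[R]_n) := (x^T *m H *m y) 0 0.
pose g (x y : 'cV[R]_n) := (x^T *m y) 0 0.
have gE (x : 'cV[R]_n) : g x x = \sum_i x i 0 ^+ 2.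
  by rewrite /g mxE; apply: eq_bigr => i _; rewrite mxE expr2.
have g_ge0 x : 0 <= g x x by rewrite gE sumr_ge0 // => i _; exact: sqr_ge0.
have g0 x : g x x = 0 -> x = 0.
  rewrite gE => /eqP; rewrite psumr_eq0 => [/allP x0|i _]; last exact: sqr_ge0.
  apply/matrixP => i j; rewrite ord1 mxE.
  by apply/eqP; rewrite -sqrf_eq0; exact: (implyP (x0 i (mem_index_enum i))).
have b0x x : b 0 x = 0 by rewrite /b trmx0 !mul0mx mxE.
have bx0 x : b x 0 = 0 by rewrite /b mulmx0 mxE.
have gx0 x : g x 0 = 0 by rewrite /g mulmx0 mxE.
have g0x x : g 0 x = 0 by rewrite /g trmx0 mul0mx mxE.
have b_ge0 x : 0 <= b x x.
  have [/g0 ->|xN0] := eqVneq (g x x) 0; first by rewrite bx0.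
  have := Hmax _ (reflection_stiefel xN0).
  rewrite reflection_tr /reflection mulmxBl mul1mx -scalemxAl raddfB /=.
  rewrite mxtraceZ mxtrace_outer -/(b x x) -/(g x x) gerBl.
  by rewrite pmulr_rge0 // divr_gt0 // lt_neqAle eq_sym xN0 g_ge0.
split=> //.
(* Clearing the denominators makes this hold for zero vectors too, and makes
   it polynomial in [t] when [y = x + t z]. *)
have two_reflections x y : 2 * g y x * b x y <= b x x * g y y + b y y * g x x.
  have [/g0 ->|xN0] := eqVneq (g x x) 0.
    by rewrite !(b0x, bx0, gx0, g0x, mulr0, mul0r, addr0).
  have [/g0 ->|yN0] := eqVneq (g y y) 0.
    by rewrite !(b0x, bx0, gx0, g0x, mulr0, mul0r, addr0).
  have xgt0 : 0 < g x x by rewrite lt_neqAle eq_sym xN0 g_ge0.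
  have ygt0 : 0 < g y y by rewrite lt_neqAle eq_sym yN0 g_ge0.
  have orth : stiefel (reflection x *m reflection y).
    rewrite /stiefel trmx_mul mulmxA -(mulmxA _ _ (reflection x)).
    by rewrite (reflection_stiefel xN0) mulmx1 (reflection_stiefel yN0).
  have := Hmax _ orth; rewrite trmx_mul !reflection_tr /reflection.
  rewrite mulmxBl mul1mx mulmxBr mulmx1 !mulmxBl mul1mx.
  rewrite -!scalemxAl -!scalemxAr -!scalemxAl !raddfB /= !mxtraceZ.
  rewrite !mxtrace_outer -/(b x x) -/(b y y) -/(g x x) -/(g y y).
  have -> : \tr (y *m y^T *m (x *m x^T) *m H) = g y x * b x y.
    rewrite mulmxA -(mulmxA y y^T) [y^T *m x]mx11_scalar.
    by rewrite mul_mx_scalar -!scalemxAl linearZ /= mxtrace_outer.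
  set c1 := 2 / g x x; set c2 := 2 / g y y.
  have -> (t B1 B2 B3 : R) :
     (t - c1 * B1 + (- (c2 * B2) - - (c2 * (c1 * B3))) <= t) =
     (c1 * c2 * B3 <= c1 * B1 + c2 * B2) by apply/idP/idP; lra.
  rewrite -(ler_pM2r (mulr_gt0 xgt0 ygt0)).
  have -> : c1 * c2 * (g y x * b x y) * (g x x * g y y) =
      2 * (2 * g y x * b x y).
    by rewrite /c1 /c2; field; rewrite ?xN0 ?yN0.
  have -> : (c1 * b x x + c2 * b y y) * (g x x * g y y) =
      2 * (b x x * g y y + b y y * g x x).
    by rewrite /c1 /c2; field; rewrite ?xN0 ?yN0.
  by rewrite ler_pM2l.
have sym x z : b x z = b z x.
  have [/g0 ->|xN0] := eqVneq (g x x) 0.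
    by rewrite b0x bx0.
  have bD u v w : b u (v + w) = b u v + b u w by rewrite /b mulmxDr mxE.
  have bDl u v w : b (v + w) u = b v u + b w u.
    by rewrite /b linearD /= !mulmxDl mxE.
  have bZ t u v : b u (t *: v) = t * b u v by rewrite /b -scalemxAr mxE.
  have bZl t u v : b (t *: v) u = t * b v u.
    by rewrite /b linearZ /= -!scalemxAl mxE.
  have gD u v w : g u (v + w) = g u v + g u w by rewrite /g mulmxDr mxE.
  have gDl u v w : g (v + w) u = g v u + g w u.
    by rewrite /g linearD /= !mulmxDl mxE.
  have gZ t u v : g u (t *: v) = t * g u v by rewrite /g -scalemxAr mxE.
  have gZl t u v : g (t *: v) u = t * g v u.
    by rewrite /g linearZ /= -!scalemxAl mxE.
  have gC : g x z = g z x by rewrite /g -[x^T *m z]trmxK trmx_mul trmxK mxE.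
  suff : (b x z - b z x) * g x x = 0.
    by move/eqP; rewrite mulf_eq0 (negbTE xN0) orbF subr_eq0 => /eqP.
  apply: (@eq0_of_linear_le_quadratic _
    (b x x * g z z + b z z * g x x - 2 * g z x * b x z)) => t.
  have := two_reflections x (x + t *: z).
  rewrite !(bD, bDl, gD, gDl, bZ, bZl, gZ, gZl) gC.
  lra.
apply/matrixP => i j; rewrite mxE.
have bdelta k l : b (delta_mx k 0) (delta_mx l 0) = H k l.
  by rewrite /b trmx_delta -rowE -colE !mxE.
by rewrite -!bdelta.
Qed.

(** A maximizer of [tr (Q^T A)] over the orthogonal group is an orthogonal
    polar factor of [A], whether or not [A] is invertible. *)
Lemma polar_factor n (A : 'M[R]_n) :
  exists2 Q : 'M[R]_n, stiefel Q & psd (Q^T *m A).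
Proof.
have [Q QO Qmax] := orthogonal_procrustes_max A.
exists Q => //; apply: psd_of_procrustes_max => P PO.
rewrite mulmxA -trmx_mul; apply: Qmax.
by rewrite /stiefel trmx_mul mulmxA -(mulmxA _ _ Q) QO mulmx1.
Qed.

End Polar.

(** * Positive semidefinite forms and matrices with orthonormal columns *)

Section Forms.
Variable R : realType.

Lemma psd_mxtrace_ge0 n p (K : 'M[R]_n) (X : 'M[R]_(n, p)) :
  psd K -> 0 <= \tr (X^T *m K *m X).
Proof.
move=> [_ K_ge0]; apply: sumr_ge0 => j _; have := K_ge0 (col j X).
congr (0 <= _); rewrite !mxE; apply: eq_bigr => i _; rewrite !mxE.
congr (_ * _).
by apply: eq_bigr => k _; rewrite !mxE.
Qed.

Lemma frobenius_mul_scaled_isometry p q s (c : R) (V : 'M[R]_(p, q))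
    (X : 'M[R]_(q, s)) :
  V^T *m V = c%:M -> frobenius (V *m X) ^+ 2 = c * frobenius X ^+ 2.
Proof.
move=> Vc; rewrite !frobenius_sqr trmx_mul mulmxA -(mulmxA _ _ V) Vc.
by rewrite mul_mx_scalar -scalemxAl mxtraceZ.
Qed.

(** Bessel's inequality: [V V^T] is [c] times a projection, and [c X - V V^T X]
    has nonnegative squared norm. *)
Lemma frobenius_trmx_mul_scaled_isometry p q s (c : R) (V : 'M[R]_(p, q))
    (X : 'M[R]_(p, s)) :
  0 < c -> V^T *m V = c%:M ->
  frobenius (V^T *m X) ^+ 2 <= c * frobenius X ^+ 2.
Proof.
move=> c0 Vc; set Y := V^T *m X.
have cross : \tr (X^T *m (V *m Y)) = frobenius Y ^+ 2.
  by rewrite frobenius_sqr {2}/Y trmx_mul trmxK mulmxA.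
have := mxtrace_gram_ge0 (c *: X - V *m Y).
rewrite [(_ - _)^T]linearB /= [(c *: X)^T]linearZ /= mulmxBl !mulmxBr.
rewrite -!scalemxAl -!scalemxAr !raddfB /= !mxtraceZ.
rewrite (mxtrace_trmx_mulC (V *m Y) X) cross -!frobenius_sqr.
rewrite (frobenius_mul_scaled_isometry _ Vc) => square_ge0.
by rewrite -(ler_pM2l c0); lra.
Qed.

Lemma frobenius_mul_stiefel p q s (V : 'M[R]_(p, q)) (X : 'M[R]_(q, s)) :
  stiefel V -> frobenius (V *m X) = frobenius X.
Proof.
move=> V1; apply/eqP; rewrite -(eqrXn2 (n := 2)) ?frobenius_ge0 //.
by rewrite (frobenius_mul_scaled_isometry _ V1) mul1r.
Qed.

(** The difference of the two sides is [tr (P K P^T)], where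
    [P := (1 - U U^T) O] is the part of [O] orthogonal to the columns of [U]. *)
Lemma mxtrace_compression_le p n (O U : 'M[R]_(p, n)) (K : 'M[R]_n) :
  stiefel O -> stiefel U -> psd K ->
  \tr ((O^T *m U)^T *m K *m (O^T *m U)) <= \tr K.
Proof.
move=> O1 U1 K_psd; rewrite -subr_ge0.
have := psd_mxtrace_ge0 (O - U *m (U^T *m O))^T K_psd; congr (0 <= _).
have -> : \tr ((O - U *m (U^T *m O))^T^T *m K *m (O - U *m (U^T *m O))^T) =
    \tr (K *m ((O - U *m (U^T *m O))^T *m (O - U *m (U^T *m O)))).
  by rewrite trmxK -mulmxA mxtrace_mulC -mulmxA.
have -> : (O - U *m (U^T *m O))^T *m (O - U *m (U^T *m O)) =
    1%:M - (O^T *m U) *m (O^T *m U)^T.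
  rewrite [(_ - _)^T]linearB /= mulmxBl !mulmxBr O1 !trmx_mul !trmxK !mulmxA.
  by rewrite -(mulmxA (_ *m _) U^T U) U1 mulmx1 subrr subr0.
rewrite mulmxBr mulmx1 raddfB /=; congr (_ - _); move: (O^T *m U) => V.
by rewrite mxtrace_mulC [RHS]mxtrace_mulC mulmxA.
Qed.

(** Both sides equal [2 tr ((1 - V^T U) K)], since
    [(U - V)^T (U - V) = 2 - U^T V - V^T U] and [K] is symmetric.  This converts
    the first-order term in the perturbation of a polar factor into a square. *)
Lemma mxtrace_stiefel_diff p n (U V : 'M[R]_(p, n)) (K : 'M[R]_n) :
  stiefel U -> stiefel V -> K^T = K ->
  2 * \tr ((U - V)^T *m (U *m K)) = \tr ((U - V) *m K *m (U - V)^T).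
Proof.
move=> U1 V1 K_sym; rewrite [RHS]mxtrace_mulC !mulmxA.
have -> : (U - V)^T *m U = 1%:M - V^T *m U.
  by rewrite [(_ - _)^T]linearB /= mulmxBl U1.
have -> : (U - V)^T *m (U - V) = (1%:M - V^T *m U) + (1%:M - V^T *m U)^T.
  rewrite ![(_ - _)^T]linearB /= mulmxBl !mulmxBr U1 V1 trmx1 trmx_mul trmxK.
  by rewrite opprB addrC.
rewrite [in RHS]mulmxDl raddfD /= mulr2n mulrDl mul1r; congr (_ + _).
by rewrite -mxtrace_tr trmx_mul K_sym mxtrace_mulC.
Qed.

End Forms.

(** * Block matrices and the optimality certificate *)

Section Blocks.
Variables (R : realType) (m r : nat) (d : 'I_m -> nat).
Local Notation N := (\sum_(i < m) d i).

Lemma submxcol_mulmx q (S : 'M[R]_N) (X : 'M[R]_(N, q)) i :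
  submxcol (S *m X) i = \sum_(j < m) submxblock S i j *m submxcol X j.
Proof.
by rewrite -{1}(submxcolK X) -{1}(submxblockK S) mul_mxblock_mxrow mxcolK.
Qed.

Lemma mxtrace_trmx_mul_blocks q (A B : 'M[R]_(N, q)) :
  \tr (A^T *m B) = \sum_(i < m) \tr ((submxcol A i)^T *m submxcol B i).
Proof.
rewrite -{1}(submxcolK A) -{1}(submxcolK B) tr_mxcol mul_mxrow_mxcol.
by rewrite raddf_sum.
Qed.

Lemma frobenius_sqr_blocks q (A : 'M[R]_(N, q)) :
  frobenius A ^+ 2 = \sum_(i < m) frobenius (submxcol A i) ^+ 2.
Proof.
rewrite frobenius_sqr mxtrace_trmx_mul_blocks.
by apply: eq_bigr => i _; rewrite frobenius_sqr.
Qed.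

Lemma feasible_gram (O : 'M[R]_(N, r)) : feasible O -> O^T *m O = m%:R%:M.
Proof.
move=> O_feas; rewrite -{1 2}(submxcolK O) tr_mxcol mul_mxrow_mxcol.
rewrite (eq_bigr (fun=> 1%:M)) => [|i _]; last exact: O_feas.
by rewrite sumr_const card_ord raddfMn.
Qed.

Lemma frobenius_le_max_block (A : 'M[R]_(N, r)) i :
  frobenius (submxcol A i) <= max_block_frobenius A.
Proof. by rewrite /max_block_frobenius (bigD1 i) //= le_max lexx. Qed.

(** Weak duality.  The gap [C - S] vanishes on the columns of [O], so its form
    at [U] only depends on the component [Z] of [U] orthogonal to [O], where
    [C >= tau >= S]. *)
Lemma global_optimum_of_certificate (S : 'M[R]_N) (O : 'M[R]_(N, r))
    (L : 'I_m -> 'M[R]_r) (tau : R) :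
  (0 < m)%N -> S^T = S -> feasible O ->
  (forall i, multiplier S O i (L i)) ->
  (forall i, psd (L i - tau%:M)) ->
  (forall Z : 'M[R]_(N, r), O^T *m Z = 0 ->
     \tr (Z^T *m S *m Z) <= tau * frobenius Z ^+ 2) ->
  global_optimum S O.
Proof.
move=> m_gt0 S_sym O_feas LO L_psd S_le; split=> // U U_feas.
rewrite !objectiveE.
pose B i := submxcol O i *m (L i - tau%:M) *m (submxcol O i)^T + tau%:M.
pose C : 'M[R]_N := \mxdiag_i B i.
have CE q (X : 'M[R]_(N, q)) i : submxcol (C *m X) i = B i *m submxcol X i.
  by rewrite -{1}(submxcolK X) mul_mxdiag_mxcol mxcolK.
have C_sym : C^T = C.
  rewrite /C tr_mxdiag; apply: eq_mxdiag => i.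
  rewrite /B linearD /= tr_scalar_mx !trmx_mul trmxK mulmxA.
  by case: (L_psd i) => ->.
have CO : C *m O = S *m O.
  apply/mxcolP => i; rewrite CE submxcol_mulmx; case: (LO i) => _ <-.
  rewrite /B mulmxDl -(mulmxA _ _ (submxcol O i)) (O_feas i) mulmx1 mulmxBr.
  by rewrite mul_mx_scalar mul_scalar_mx subrK.
(* With [X = Z] each first summand is nonnegative, which gives [C >= tau]; with
   [X = U] it is a compression, so at most its value at [X = O]. *)
have C_form (X : 'M[R]_(N, r)) : \tr (X^T *m C *m X) =
    \sum_i (\tr (((submxcol O i)^T *m submxcol X i)^T *m (L i - tau%:M) *m
                 ((submxcol O i)^T *m submxcol X i))
            + tau * frobenius (submxcol X i) ^+ 2).
  rewrite -mulmxA mxtrace_trmx_mul_blocks; apply: eq_bigr => i _.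
  rewrite CE /B mulmxDl mulmxDr raddfD /= mul_scalar_mx -scalemxAr mxtraceZ.
  by rewrite frobenius_sqr trmx_mul trmxK !mulmxA.
have mN0 : m%:R != 0 :> R by rewrite pnatr_eq0 -lt0n.
pose Z := U - O *m (m%:R^-1 *: (O^T *m U)).
have OZ : O^T *m Z = 0.
  rewrite mulmxBr mulmxA (feasible_gram O_feas) mul_scalar_mx scalerA.
  by rewrite divff // scale1r subrr.
have gapO : (C - S) *m O = 0 by rewrite mulmxBl CO subrr.
have Ogap : O^T *m (C - S) = 0.
  by rewrite -[LHS]trmxK trmx_mul trmxK linearB /= C_sym S_sym gapO trmx0.
have gapE : U^T *m (C - S) *m U = Z^T *m (C - S) *m Z.
  have -> : U^T *m (C - S) = Z^T *m (C - S).
    rewrite /Z [(_ - _)^T in RHS]linearB /= [RHS]mulmxBl trmx_mul.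
    by rewrite -(mulmxA _ O^T) Ogap mulmx0 subr0.
  rewrite -!(mulmxA Z^T); congr (_ *m _).
  by rewrite /Z [RHS]mulmxBr (mulmxA (C - S) O) gapO mul0mx subr0.
apply: (@le_trans _ _ (\tr (U^T *m C *m U))).
  rewrite -subr_ge0 -raddfB /= -mulmxBl -mulmxBr gapE.
  rewrite (mulmxBr Z^T) (mulmxBl (Z^T *m C)) raddfB /=.
  rewrite subr_ge0 (le_trans (S_le _ OZ)) // C_form.
  rewrite frobenius_sqr_blocks mulr_sumr.
  by apply: ler_sum => i _; rewrite lerDr psd_mxtrace_ge0.
rewrite C_form -mulmxA -CO mulmxA C_form; apply: ler_sum => i _.
rewrite (O_feas i) trmx1 mul1mx mulmx1 !frobenius_sqr (O_feas i).
rewrite (U_feas i) lerD2r.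
exact: mxtrace_compression_le.
Qed.

End Blocks.

(** * Estimates at a point aligned with the signal *)

Section Aligned.
Variables (R : realType) (m r : nat) (d : 'I_m -> nat).
Local Notation N := (\sum_(i < m) d i).
Variables (Theta O : 'M[R]_(N, r)) (W : 'M[R]_N).
Hypothesis m_gt0 : (0 < m)%N.
Hypotheses (Theta_feas : feasible Theta) (O_feas : feasible O).
Hypothesis W_sym : W^T = W.
Hypothesis aligned : psd (Theta^T *m O).

Local Notation D := (O - Theta).
Local Notation H := (Theta^T *m O).
Local Notation w := (opnorm W).
Local Notation q := (Num.sqrt (r%:R / m%:R) : R).
Local Notation h := (m%:R - 4 * w * Num.sqrt r%:R).
Local Notation a := (max_block_frobenius (W *m Theta) + 4 * w ^+ 2 * q).
Local Notation S := (Theta *m Theta^T + W).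

Let m_pos : 0 < m%:R :> R. Proof. by rewrite ltr0n. Qed.

Let q_sqr : q ^+ 2 = r%:R / m%:R.
Proof. by rewrite sqr_sqrtr // divr_ge0. Qed.

Lemma aligned_gram : D^T *m D = 2 *: (m%:R%:M - H).
Proof.
rewrite [(_ - _)^T]linearB /= mulmxBl !mulmxBr (feasible_gram O_feas).
rewrite (feasible_gram Theta_feas).
have -> : O^T *m Theta = H by case: aligned => <- _; rewrite trmx_mul trmxK.
by rewrite scaler_nat mulr2n opprB addrA addrAC.
Qed.

(** With [t := tr H], the signal loses [m^2 r - tr (H^2)], which is at least
    [m (m r - t) = m |D|^2 / 2] since [tr (H (m - H)) >= 0].  The noise gains
    [tr (D^T W (O + Theta))], at most [2 |D| w m q].  Both bounds together leave
    [|D| <= 4 w q]. *)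
Lemma aligned_distance :
  \tr (Theta^T *m S *m Theta) <= \tr (O^T *m S *m O) ->
  frobenius D <= 4 * w * q.
Proof.
move=> obj_le; set dl := frobenius D.
have w0 : 0 <= w by exact: opnorm_ge0.
have q0 : 0 <= q by exact: sqrtr_ge0.
have dl0 : 0 <= dl by exact: frobenius_ge0.
have rE : r%:R = m%:R * q ^+ 2 by rewrite q_sqr mulrC divfK // gt_eqF ?m_pos.
have dlE : dl ^+ 2 = 2 * (m%:R * r%:R - \tr H).
  rewrite frobenius_sqr aligned_gram mxtraceZ raddfB /= mxtrace_scalar.
  by rewrite mulr_natr.
have HH_le : \tr (H *m H) <= m%:R * \tr H.
  have := psd_mxtrace_ge0 D^T aligned.
  rewrite trmxK mxtrace_mulC (mulmxA D^T D) aligned_gram -scalemxAl mxtraceZ.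
  rewrite mulmxBl mul_scalar_mx raddfB /= mxtraceZ.
  by rewrite pmulr_rge0 // subr_ge0.
have OE : \tr (O^T *m S *m O) = \tr (H *m H) + \tr (O^T *m W *m O).
  rewrite mulmxDr mulmxDl raddfD /=; congr (_ + _).
  have OTheta : O^T *m Theta = H.
    by case: aligned => <- _; rewrite trmx_mul trmxK.
  by rewrite (mulmxA O^T) OTheta -(mulmxA H).
have ThetaE : \tr (Theta^T *m S *m Theta) =
    m%:R ^+ 2 * r%:R + \tr (Theta^T *m W *m Theta).
  rewrite mulmxDr mulmxDl raddfD /=; congr (_ + _).
  rewrite mulmxA -mulmxA (feasible_gram Theta_feas) -scalar_mxM mxtrace_scalar.
  by rewrite [RHS]mulr_natr expr2.
have noise_le : \tr (O^T *m W *m O) - \tr (Theta^T *m W *m Theta) <=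
    dl * (w * (2 * (m%:R * q))).
  have -> : \tr (O^T *m W *m O) - \tr (Theta^T *m W *m Theta) =
      \tr (D^T *m (W *m (O + Theta))).
    rewrite [(_ - _)^T]linearB /= mulmxDr mulmxDr !mulmxBl !(raddfD, raddfB) /=.
    have -> : \tr (O^T *m (W *m Theta)) = \tr (Theta^T *m (W *m O)).
      by rewrite mxtrace_trmx_mulC trmx_mul W_sym !mulmxA.
    by rewrite !mulmxA; ring.
  apply: le_trans (mxtrace_trmx_mul_le _ _) _; rewrite ler_wpM2l //.
  apply: le_trans (frobenius_mul_opnorm _ _) _; rewrite ler_wpM2l //.
  apply: le_trans (frobeniusD _ _) _.
  have norm_feas (V : 'M[R]_(N, r)) : feasible V -> frobenius V = m%:R * q.
    move=> V_feas; apply/eqP.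
    rewrite -(eqrXn2 (n := 2)) ?mulr_ge0 ?frobenius_ge0 //.
    rewrite frobenius_sqr (feasible_gram V_feas) mxtrace_scalar exprMn q_sqr.
    by rewrite -(mulr_natr m%:R r); apply/eqP; field; rewrite gt_eqF ?m_pos.
  by rewrite !norm_feas //; lra.
rewrite ThetaE OE in obj_le.
have : m%:R * (dl * dl) <= m%:R * (dl * (4 * w * q)).
  have -> : m%:R * (dl * dl) = 2 * (m%:R ^+ 2 * r%:R - m%:R * \tr H).
    by rewrite -expr2 dlE; ring.
  lra.
rewrite ler_pM2l ?m_pos //; have [->|dlN0] := eqVneq dl 0.
  by move=> _; rewrite !mulr_ge0.
by rewrite ler_pM2l // lt_neqAle eq_sym dlN0.
Qed.

Hypothesis D_le : frobenius D <= 4 * w * q.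
Hypothesis h_gt0 : 0 < h.

(** Since [m - H = D^T D / 2] is at most [8 (w q)^2], the form of [H] is bounded
    below by [m - 8 (w q)^2], which is at least [h] because [h > 0] forces
    [4 w q < sqrt m]. *)
Lemma aligned_overlap_ge p (X : 'M[R]_(r, p)) :
  h * frobenius X ^+ 2 <= \tr (X^T *m H *m X).
Proof.
have w0 : 0 <= w by exact: opnorm_ge0.
have q0 : 0 <= q by exact: sqrtr_ge0.
pose s : R := Num.sqrt m%:R.
have s_gt0 : 0 < s by rewrite sqrtr_gt0 m_pos.
have sE : s ^+ 2 = m%:R by rewrite sqr_sqrtr ?ler0n.
have rE : Num.sqrt r%:R = q * s.
  by rewrite -sqrtrM ?divr_ge0 // divfK // gt_eqF ?m_pos.
have formE : \tr (X^T *m H *m X) =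
    m%:R * frobenius X ^+ 2 - frobenius (D *m X) ^+ 2 / 2.
  have -> : frobenius (D *m X) ^+ 2 = \tr (X^T *m (D^T *m D) *m X).
    by rewrite frobenius_sqr trmx_mul !mulmxA.
  rewrite aligned_gram -scalemxAr -scalemxAl mxtraceZ.
  rewrite mulmxBr mulmxBl raddfB /= mul_mx_scalar -scalemxAl mxtraceZ.
  by rewrite -frobenius_sqr; field.
have DX_le : frobenius (D *m X) ^+ 2 <= (4 * w * q) ^+ 2 * frobenius X ^+ 2.
  rewrite -exprMn lerXn2r ?nnegrE ?mulr_ge0 ?frobenius_ge0 //.
  apply: le_trans (frobenius_mul _ _) _.
  by rewrite ler_wpM2r ?frobenius_ge0.
have X0 : 0 <= frobenius X ^+ 2 by exact: sqr_ge0.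
have c_le : (4 * w * q) ^+ 2 / 2 <= 4 * w * Num.sqrt r%:R.
  have wqs : 4 * w * q < s.
    by rewrite -(ltr_pM2r s_gt0) -expr2 sE -(mulrA (4 * w) q s) -rE -subr_gt0.
  have wq0 : 0 <= 4 * w * q by rewrite !mulr_ge0.
  rewrite rE mulrA; move: (4 * w * q) wqs wq0 => u; nra.
rewrite formE; move: (frobenius X ^+ 2) X0 DX_le => x x0 DX_le.
have := ler_wpM2r x0 c_le; lra.
Qed.

Lemma overlap_le p (X : 'M[R]_(r, p)) :
  frobenius (H *m X) <= m%:R * frobenius X.
Proof.
rewrite -(ler_pXn2r (n := 2)) ?nnegrE ?mulr_ge0 ?frobenius_ge0 ?ler0n //.
rewrite -mulmxA exprMn.
apply: le_trans
  (frobenius_trmx_mul_scaled_isometry _ m_pos (feasible_gram Theta_feas)) _.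
by rewrite (frobenius_mul_scaled_isometry _ (feasible_gram O_feas)) mulrA expr2.
Qed.

Lemma block_noise_le i : frobenius (submxcol (W *m O) i) <= a.
Proof.
have -> : W *m O = W *m Theta + W *m D by rewrite -mulmxDr addrC subrK.
rewrite submxcolD; apply: le_trans (frobeniusD _ _) _.
apply: lerD; first exact: frobenius_le_max_block.
apply: (@le_trans _ _ (frobenius (W *m D))).
  rewrite -(ler_pXn2r (n := 2)) ?nnegrE ?frobenius_ge0 //.
  have le_sum (f : 'I_m -> R) : (forall j, 0 <= f j) -> f i <= \sum_j f j.
    by move=> f0; rewrite (bigD1 i) //= lerDl sumr_ge0.
  rewrite (frobenius_sqr_blocks (W *m D)).
  apply: (le_sum (fun j => frobenius (submxcol (W *m D) j) ^+ 2)) => j.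
  exact: sqr_ge0.
apply: le_trans (frobenius_mul_opnorm _ _) _.
have -> : 4 * w ^+ 2 * q = w * (4 * w * q) by ring.
by rewrite ler_wpM2l ?opnorm_ge0.
Qed.

Lemma multiplier_aligned i L : multiplier S O i L ->
  submxcol O i *m L = submxcol Theta i *m H + submxcol (W *m O) i.
Proof.
case=> _ ->; rewrite -submxcol_mulmx mulmxDl submxcolD.
by rewrite -mulmxA -submxcol_mul.
Qed.

(** Pair stationarity [O_i L - Theta_i H = (W O)_i] with [D_i].  By
    [mxtrace_stiefel_diff] the left side gives half the forms of [L] and of [H]
    at [D_i]; the first is nonnegative and the second at least [h |D_i|^2]. *)
Lemma block_distance i L : multiplier S O i L -> psd L ->
  frobenius (submxcol D i) <= 2 * a / h.
Proof.
move=> LO L_psd; set E := submxcol (W *m O) i.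
set Di := submxcol D i; set Oi := submxcol O i; set Ti := submxcol Theta i.
have DiE : Di = Oi - Ti by rewrite /Di submxcolB.
have stationarity : Oi *m L = Ti *m H + E by exact: multiplier_aligned.
have E_le : frobenius E <= a by exact: block_noise_le.
have L_ge0 : 0 <= \tr (Di *m L *m Di^T).
  by rewrite -{1}[Di]trmxK psd_mxtrace_ge0.
have H_ge : h * frobenius Di ^+ 2 <= \tr (Di *m H *m Di^T).
  by rewrite -{2}[Di]trmxK -frobenius_tr aligned_overlap_ge.
have H_sym : H^T = H by case: aligned.
have eqE : \tr (Di^T *m E) =
    (\tr (Di *m L *m Di^T) + \tr (Di *m H *m Di^T)) / 2.
  have -> : E = Oi *m L - Ti *m H.
    by rewrite stationarity addrC addrA addNr add0r.
  have := mxtrace_stiefel_diff (O_feas i) (Theta_feas i) (proj1 L_psd).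
  have := mxtrace_stiefel_diff (Theta_feas i) (O_feas i) H_sym.
  rewrite -/Oi -/Ti -DiE -[Ti - Oi]opprB -DiE.
  rewrite ![(- Di)^T]linearN /= !mulNmx mulmxN opprK raddfN /= => e1 e2.
  by rewrite mulmxBr raddfB /=; lra.
have := mxtrace_trmx_mul_le Di E; rewrite eqE => h1.
have D0 : 0 <= frobenius Di by exact: frobenius_ge0.
rewrite ler_pdivlMr // mulrC.
have [->|DN0] := eqVneq (frobenius Di) 0.
  by rewrite mulr0 mulr_ge0 // (le_trans _ E_le) ?frobenius_ge0.
have Dgt0 : 0 < frobenius Di by rewrite lt_neqAle eq_sym DN0.
rewrite -(ler_pM2r Dgt0); have := ler_wpM2l D0 E_le; lra.
Qed.

(** [L = H + D_i^T Theta_i H + O_i^T (W O)_i], where [H >= h], [|H| <= m] and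
    the two perturbations are controlled by [block_distance] and
    [block_noise_le]. *)
Lemma multiplier_form_ge i L p (X : 'M[R]_(r, p)) :
  multiplier S O i L -> psd L ->
  (h - 2 * m%:R * a / h - a) * frobenius X ^+ 2 <= \tr (X^T *m L *m X).
Proof.
move=> LO L_psd; set E := submxcol (W *m O) i.
set Di := submxcol D i; set Oi := submxcol O i; set Ti := submxcol Theta i.
have DiE : Di = Oi - Ti by rewrite /Di submxcolB.
have stationarity : Oi *m L = Ti *m H + E by exact: multiplier_aligned.
have LE : L = H + (Di^T *m (Ti *m H) + Oi^T *m E).
  rewrite -[LHS]mul1mx -(O_feas i) -mulmxA -/Oi stationarity mulmxDr addrA.
  congr (_ + _); rewrite -{2}[H]mul1mx -(Theta_feas i) -/Ti -mulmxA -mulmxDl.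
  by rewrite DiE -linearD /= addrC subrK.
have -> : \tr (X^T *m L *m X) = \tr (X^T *m H *m X)
    - \tr ((- Di *m X)^T *m (Ti *m (H *m X))) - \tr ((- Oi *m X)^T *m (E *m X)).
  rewrite LE !(mulmxDr, mulmxDl) !raddfD /= !trmx_mul ![(- _)^T]linearN /=.
  by rewrite !mulmxN !mulNmx !raddfN /= !opprK !mulmxA addrA.
have X0 : 0 <= frobenius X by exact: frobenius_ge0.
have term1 : \tr ((- Di *m X)^T *m (Ti *m (H *m X))) <=
    (2 * a / h) * m%:R * frobenius X ^+ 2.
  apply: le_trans (mxtrace_trmx_mul_le _ _) _.
  rewrite (frobenius_mul_stiefel _ (Theta_feas i)).
  have -> : 2 * a / h * m%:R * frobenius X ^+ 2 =
    (2 * a / h * frobenius X) * (m%:R * frobenius X) by ring.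
  apply: ler_pM; rewrite ?frobenius_ge0 ?overlap_le //.
  apply: le_trans (frobenius_mul _ _) _; rewrite ler_wpM2r //.
  by rewrite frobeniusN (block_distance LO L_psd).
have term2 : \tr ((- Oi *m X)^T *m (E *m X)) <= a * frobenius X ^+ 2.
  apply: le_trans (mxtrace_trmx_mul_le _ _) _.
  rewrite mulNmx frobeniusN (frobenius_mul_stiefel _ (O_feas i)) mulrC.
  have -> : a * frobenius X ^+ 2 = a * frobenius X * frobenius X by ring.
  rewrite ler_wpM2r //; apply: le_trans (frobenius_mul _ _) _.
  by rewrite ler_wpM2r // block_noise_le.
have := aligned_overlap_ge X.
have -> : 2 * m%:R * a / h = 2 * a / h * m%:R by ring.
lra.
Qed.

Lemma form_orthogonal_le (Z : 'M[R]_(N, r)) : O^T *m Z = 0 ->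
  \tr (Z^T *m S *m Z) <= (w + 16 * w ^+ 2 * (r%:R / m%:R)) * frobenius Z ^+ 2.
Proof.
move=> OZ; have Z0 : 0 <= frobenius Z by exact: frobenius_ge0.
have ThetaZ : Theta^T *m Z = - (D^T *m Z).
  by rewrite [(_ - _)^T]linearB /= mulmxBl OZ sub0r opprK.
rewrite mulmxDr mulmxDl raddfD /= mulrDl addrC; apply: lerD.
  rewrite -mulmxA; apply: le_trans (mxtrace_trmx_mul_le _ _) _.
  by rewrite mulrC expr2 mulrA ler_wpM2r // frobenius_mul_opnorm.
have -> : Z^T *m (Theta *m Theta^T) *m Z = (Theta^T *m Z)^T *m (Theta^T *m Z).
  by rewrite trmx_mul trmxK !mulmxA.
rewrite -frobenius_sqr ThetaZ frobeniusN -q_sqr.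
have -> : 16 * w ^+ 2 * q ^+ 2 * frobenius Z ^+ 2 =
    (4 * w * q * frobenius Z) ^+ 2 by ring.
rewrite lerXn2r ?nnegrE ?mulr_ge0 ?frobenius_ge0 ?opnorm_ge0 ?sqrtr_ge0 //.
by apply: le_trans (frobenius_mul _ _) _; rewrite frobenius_tr ler_wpM2r.
Qed.

End Aligned.

(** * Global optimality *)

Theorem theorem3p10 (R : realType) (m r : nat) (d : 'I_m -> nat)
  (m_ge1 : (1 <= m)%N) (r_ge1 : (1 <= r)%N) (r_le_d : forall i, (r <= d i)%N)
  (Theta : 'M[R]_(\sum_(i < m) d i, r)) (W S : 'M[R]_(\sum_(i < m) d i))
  (Theta_feasible : forall i, stiefel (submxcol Theta i))
  (W_sym : W^T = W)
  (S_model : S = Theta *m Theta^T + W)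
  (denominator_gt0 : 0 < m%:R - 4 * opnorm W * Num.sqrt r%:R)
  (W_small :
     opnorm W * (4 * Num.sqrt r%:R + 1)
       + max_block_frobenius (W *m Theta)
       + 4 * opnorm W ^+ 2 * Num.sqrt (r%:R / m%:R)
       + 2 * m%:R * (max_block_frobenius (W *m Theta)
                       + 4 * opnorm W ^+ 2 * Num.sqrt (r%:R / m%:R))
           / (m%:R - 4 * opnorm W * Num.sqrt r%:R)
       + 16 * opnorm W ^+ 2 * (r%:R / m%:R)
     <= m%:R) :
  forall O : 'M[R]_(\sum_(i < m) d i, r),
    candidate_critical_point S O ->
    \tr (Theta^T *m S *m Theta) <= \tr (O^T *m S *m O) ->
    global_optimum S O.
Proof.
move=> O [[O_feas critical] multipliers_psd] obj_le.
have [Q Q1 Q_psd] := polar_factor (Theta^T *m O).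
have QQ : Q *m Q^T = 1%:M by apply: mulmx1C.
pose T := Theta *m Q.
have T_feas : feasible T.
  move=> i; rewrite /stiefel /T -submxcol_mul trmx_mul mulmxA -(mulmxA Q^T).
  by rewrite (Theta_feasible i) mulmx1.
have TT : T *m T^T = Theta *m Theta^T.
  by rewrite /T trmx_mul mulmxA -(mulmxA Theta) QQ mulmx1.
have T_aligned : psd (T^T *m O) by rewrite /T trmx_mul -mulmxA.
have T_obj : \tr (T^T *m S *m T) = \tr (Theta^T *m S *m Theta).
  by rewrite mxtrace_mulC mulmxA TT [RHS]mxtrace_mulC mulmxA.
have T_noise : max_block_frobenius (W *m T) = max_block_frobenius (W *m Theta).
  apply: eq_bigr => i _; rewrite /T mulmxA -submxcol_mul -frobenius_tr trmx_mul.
  by rewrite frobenius_mul_stiefel ?frobenius_tr // /stiefel trmxK.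
have T_model : S = T *m T^T + W by rewrite TT.
rewrite -T_obj in obj_le; rewrite -T_noise in W_small.
move: T_model obj_le critical multipliers_psd => ->.
move=> obj_le critical multipliers_psd.
have D_le := aligned_distance m_ge1 T_feas O_feas W_sym T_aligned obj_le.
have [L LO] := choice critical.
pose tau := opnorm W + 16 * opnorm W ^+ 2 * (r%:R / m%:R).
apply: (@global_optimum_of_certificate _ _ _ _ _ _ L tau) => //.
- by rewrite linearD /= W_sym trmx_mul trmxK.
- move=> i; have L_psd := multipliers_psd i _ (LO i); split.
    by rewrite linearB /= tr_scalar_mx; case: (LO i) => ->.
  move=> x; rewrite -trace_mx11 mulmxBr mulmxBl raddfB /= mul_mx_scalar.
  rewrite -scalemxAl mxtraceZ -frobenius_sqr subr_ge0.
  have := multiplier_form_ge m_ge1 T_feas O_feas T_aligned D_le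
            denominator_gt0 x (LO i) L_psd.
  by apply: le_trans; rewrite ler_wpM2r ?sqr_ge0 // /tau; lra.
- exact: form_orthogonal_le.
Qed.
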